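(* Let $P,Q\in\mathbb Z[x]$ be nonzero polynomials with $P(0)=Q(0)=0$ and let $a,n\in\mathbb N$. The following are equivalent. 1. There are $\alpha\sim\beta\sim\gamma$ in ${}^*\mathbb N$ with $(\alpha,\beta)$ a Ramsey pair such that $a\alpha^n+P(\beta)=Q(\gamma)$. 2. The polynomial $ax^n+P(y)-Q(z)$ is either $a(x+y-z)$ or $a(x-y+z)$.
   Context: $\mathbb N$ is the set of positive integers. ${}^*\mathbb N$ is a fixed $\mathfrak c^+$-saturated elementary extension (nonstandard extension) of $\mathbb N$ equipped with its full first-order structure (a symbol for every subset of every $\mathbb N^k$); ${}^*A$ is the nonstandard extension of $A\subseteq\mathbb N^k$, and functions on $\mathbb N^k$ are denoted by the same symbol as their nonstandard extensions. For $\alpha\in{}^*\mathbb N^k$, $\mathfrak u(\alpha)=\{A\subseteq\mathbb N^k\mid\alpha\in{}^*A\}\in\beta\mathbb N^k$ (the space of ultrafilters on $\mathbb N^k$), and $\alpha\sim\alpha'$ means $\mathfrak u(\alpha)=\mathfrak u(\alpha')$. For $H\subseteq\mathbb N$, $[H]^2=\{(h_1,h_2)\in H^2\mid h_1<h_2\}$. An ultrafilter $u$ on $\mathbb N^2$ is a Ramsey's witness, $u\in\mathrm{RW}$, if for every $A\in u$ there is an infinite $H\subseteq\mathbb N$ with $[H]^2\subseteq A$. A pair $(\alpha,\beta)\in{}^*\mathbb N^2$ is a Ramsey pair if $\mathfrak u(\alpha,\beta)\in\mathrm{RW}$. *)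

(* Defs.v *)
From HB Require Import structures.
From mathcomp Require Import all_boot all_order all_algebra.
From mathcomp Require Import boolp classical_sets functions cardinality filter.

Set Implicit Arguments.
Unset Strict Implicit.
Unset Printing Implicit Defensive.

Local Open Scope classical_set_scope.

Record posN := PosN { posN_val :> nat; posN_gt0 : 0 < posN_val }.
HB.instance Definition _ := [isSub for posN_val].
HB.instance Definition _ := [Choice of posN by <:].
HB.instance Definition _ := [Countable of posN by <:].

(* First-order formulas with equality, in the language with one relation symbol
   for each subset of each power of posN (functions enter through their graphs).
   V is the type of the names of the free variables and parameters; a quantifier
   binds the new name None. *)
Inductive formula (V : Type) : Type :=
| Eq of V & V
| Rel k of set (k.-tuple posN) & k.-tuple V
| Not of formula V
| And of formula V & formula V
| Ex of formula (option V).

Definition interpretation (M : Type) :=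
  forall k, set (k.-tuple posN) -> set (k.-tuple M).

Fixpoint holds (M : Type) (I : interpretation M) (V : Type) (f : formula V) :
    (V -> M) -> Prop :=
  match f with
  | Eq x y => fun e => e x = e y
  | Rel k A t => fun e => I k A (map_tuple e t)
  | Not g => fun e => ~ holds I g e
  | And g h => fun e => holds I g e /\ holds I h e
  | Ex g => fun e => exists x : M, holds I g (oapp e x)
  end.

Definition standard : interpretation posN := fun k A => A.

(* Sentences with parameters in posN: every parameter is its own name. *)
Definition elementary (M : Type) (I : interpretation M) (j : posN -> M) : Prop :=
  forall f : formula posN, holds standard f id <-> holds I f j.

(* A set of formulas over C in the single variable None, the elements of C
   being their own names. *)
Definition realizes (M : Type) (I : interpretation M) (C : set M)
    (G : set (formula (option C))) (x : M) : Prop :=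
  forall f, G f -> holds I f (oapp (fun c : C => val c) x).

(* |C| < c^+ means |C| <= c, and c is the cardinality of the powerset of posN. *)
Definition continuum_succ_saturated (M : Type) (I : interpretation M) : Prop :=
  forall (C : set M) (G : set (formula (option C))),
    (C #<= [set: set posN])%card ->
    (forall D : set (formula (option C)), finite_set D -> D `<=` G ->
       exists x, realizes I D x) ->
    exists x, realizes I G x.

Record nonstandard_extension := NonstandardExtension {
  starN :> Type;
  star : interpretation starN;
  std : posN -> starN;
  std_elementary : elementary star std;
  star_saturated : continuum_succ_saturated star
}.
Arguments star {_} [k] _ _.

Definition ultra (X : nonstandard_extension) k (v : k.-tuple X) :
    set_system (k.-tuple posN) :=
  [set A | star A v].

Definition equi (X : nonstandard_extension) (x y : X) : Prop :=
  ultra [tuple x] = ultra [tuple y].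

Definition pairs_lt (H : set posN) : set (2.-tuple posN) :=
  [set p | [/\ H (tnth p 0%R), H (tnth p 1%R) & tnth p 0%R < tnth p 1%R]].

Definition ramsey_witness (u : set_system (2.-tuple posN)) : Prop :=
  UltraFilter u /\
  forall A, u A -> exists H : set posN, infinite_set H /\ pairs_lt H `<=` A.

Definition ramsey_pair (X : nonstandard_extension) (x y : X) : Prop :=
  ramsey_witness (ultra [tuple x; y]).

(* Equality at v of the nonstandard extensions of two integer-valued functions.
   The hyperintegers are not built as a type: by transfer, the extensions of F
   and G take the same value at v exactly when v belongs to the extension of the
   set where F and G agree. *)
Definition star_eq (X : nonstandard_extension) k (F G : k.-tuple posN -> int)
    (v : k.-tuple X) : Prop :=
  star [set w | F w = G w] v.

(* Main.v *)
(* By saturation the nonstandard points can be traded for an ultrafilter F on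
   posN^3 with equal marginals whose projection to the first two coordinates is
   a Ramsey's witness.

   From (2) to (1), for x + y = z take F to be the law of (i, j, i + j) where
   (i, j) follows the tensor square of an idempotent ultrafilter; for
   x + z = y take the law of (j - i, k - i, k - j) where (i, j, k) follows a
   tensor cube.

   From (1) to (2), a Ramsey pair satisfies, for every f : N -> N, either
   f x = f y or phi (x) < f y for every phi; in particular y exceeds every
   function of x. If deg Q >= 2, the values of Q are sparse enough for z to be a
   function of y, hence z >= y since no ultrafilter is fixed by a decreasing
   function; symmetrically y >= z if deg P >= 2. Comparing sizes leaves
   deg P = deg Q = 1, and comparing logarithms makes the leading coefficients
   equal: a x^n + p y = p z. Let l be a prime larger than a + |p|. Every digit
   of a number in base l at a position depending only on the number has the same
   type for x, y and z. By the dichotomy above v_l(x) = v_l(y) or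
   n v_l(x) < v_l(y); reading off v_l and the digits at positions v_l and n v_l
   of both sides forces n = 1, and p = -a in the first case, p = a in the
   second. *)
Require Import Defs.
From HB Require Import structures.
From mathcomp Require Import all_boot all_order all_algebra.
From mathcomp Require Import boolp classical_sets functions cardinality filter.
From mathcomp Require Import mpoly.
From mathcomp Require Import zify ring.

Set Implicit Arguments.
Unset Strict Implicit.
Unset Printing Implicit Defensive.

Import Order.TTheory GRing.Theory Num.Theory.

Local Open Scope classical_set_scope.

(** * Transfer and saturation *)

Section Transfer.

Variable X : nonstandard_extension.

Definition All V (f : formula (option V)) : formula V := Not (Ex (Not f)).
Definition Imp V (f g : formula V) : formula V := Not (And f (Not g)).

Lemma holds_All M (I : interpretation M) V (f : formula (option V)) e :
  holds I (All f) e <-> forall x, holds I f (oapp e x).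
Proof.
split=> [h x|h [x]]; last by apply; apply: h.
by apply: contrapT => hx; apply: h; exists x.
Qed.

Lemma holds_Imp M (I : interpretation M) V (f g : formula V) e :
  holds I (Imp f g) e <-> (holds I f e -> holds I g e).
Proof.
split=> [h hf|h [/h ?]]; last by [].
by apply: contrapT => hg; apply: h.
Qed.

(** Elementarity speaks of parameters in [posN] only, so points of X enter through universally
    quantified variables; four of them serve a triple and its code. *)
Lemma transfer_All (f : formula (option (option (option (option posN))))) :
  (forall p q r s : posN,
     holds standard f (oapp (oapp (oapp (oapp id p) q) r) s)) ->
  forall x y z t : X,
    holds (@star X) f (oapp (oapp (oapp (oapp (@std X) x) y) z) t).
Proof.
move=> hf.
suff: holds (@star X) (All (All (All (All f)))) (@std X).
  by move=> + x y z t;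
    move=> /holds_All/(_ x)/holds_All/(_ y)/holds_All/(_ z)/holds_All/(_ t).
apply/(@std_elementary X); apply/holds_All => p; apply/holds_All => q.
by apply/holds_All => r; apply/holds_All => s.
Qed.

End Transfer.

Lemma UltraFilter_setC T (F : set_system T) : ProperFilter F ->
  (forall A, F A \/ F (~` A)) -> UltraFilter F.
Proof.
move=> PF FC; split=> // G PG FG; apply/seteqP; split=> // A GA.
case: (FC A) => // /FG GnA.
have G0 := @filter_not_empty _ G PG.
by exfalso; apply: G0; rewrite -(setICr A); exact: filterI.
Qed.

Lemma ultra_fmap T U (f : T -> U) (F : set_system T) :
  UltraFilter F -> UltraFilter [set A | F (f @^-1` A)].
Proof.
move=> FU; apply: UltraFilter_setC => A; exact: (in_ultra_setVsetC (f @^-1` A)).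
Qed.

Section Ultra.

Variable X : nonstandard_extension.
Implicit Types x y z t : X.

Lemma map_tuple1 U V (e : U -> V) a : map_tuple e [tuple a] = [tuple e a].
Proof. exact: val_inj. Qed.

Lemma map_tuple2 U V (e : U -> V) a b :
  map_tuple e [tuple a; b] = [tuple e a; e b].
Proof. exact: val_inj. Qed.

Lemma map_tuple3 U V (e : U -> V) a b c :
  map_tuple e [tuple a; b; c] = [tuple e a; e b; e c].
Proof. exact: val_inj. Qed.

Lemma map_tuple4 U V (e : U -> V) a b c d :
  map_tuple e [tuple a; b; c; d] = [tuple e a; e b; e c; e d].
Proof. exact: val_inj. Qed.

Notation V4 := (option (option (option (option posN)))).
Notation v1 := (Some (Some (Some None)) : V4).
Notation v2 := (Some (Some None) : V4).
Notation v3 := (Some None : V4).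
Notation v4 := (None : V4).

(** Turns the [~ (A /\ ~ B)] to which [Imp] unfolds back into implications. *)
Let clausify := (map_tuple1, map_tuple2, map_tuple3, map_tuple4,
  =^~ not_implyE, notK).

Ltac transfer f x y z t :=
  have := @transfer_All X f _ x y z t;
  rewrite /= ?clausify /=; apply=> p q r s; rewrite ?clausify /=.

Lemma starS (A B : set (3.-tuple posN)) x y z :
  A `<=` B -> star A [tuple x; y; z] -> star B [tuple x; y; z].
Proof.
move=> AB.
transfer (Imp (Rel A [tuple v1; v2; v3]) (Rel B [tuple v1; v2; v3])) x y z z.
exact: AB.
Qed.

Lemma starI (A B : set (3.-tuple posN)) x y z :
  star A [tuple x; y; z] -> star B [tuple x; y; z] ->
  star (A `&` B) [tuple x; y; z].
Proof.
transfer (Imp (Rel A [tuple v1; v2; v3]) (Imp (Rel B [tuple v1; v2; v3])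
       (Rel (A `&` B) [tuple v1; v2; v3]))) x y z z.
by [].
Qed.

Lemma starC (A : set (3.-tuple posN)) x y z :
  star (~` A) [tuple x; y; z] <-> ~ star A [tuple x; y; z].
Proof.
split.
  transfer (Imp (Rel (~` A) [tuple v1; v2; v3])
    (Not (Rel A [tuple v1; v2; v3]))) x y z z.
  by [].
transfer (Imp (Not (Rel A [tuple v1; v2; v3]))
  (Rel (~` A) [tuple v1; v2; v3])) x y z z.
by [].
Qed.

Lemma ultra_UltraFilter x y z : UltraFilter (ultra [tuple x; y; z]).
Proof.
have starT : star [set: 3.-tuple posN] [tuple x; y; z].
  by transfer (Rel [set: 3.-tuple posN] [tuple v1; v2; v3]) x y z z.
apply: UltraFilter_setC => [|A]; last first.
  by rewrite /ultra /=; case: (EM (star A [tuple x; y; z]));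
     [left|right; exact/starC].
split; last by split=> //; move=> A B; [exact: starI|exact: starS].
by rewrite /ultra /=; move: starT; rewrite -setC0 => /starC.
Qed.

Lemma star_fst3 (A : set (1.-tuple posN)) x y z :
  star A [tuple x] <-> star [set w | A [tuple tnth w 0%R]] [tuple x; y; z].
Proof.
split.
  by transfer (Imp (Rel A [tuple v1]) (Rel [set w | A [tuple tnth w 0%R]]
    [tuple v1; v2; v3])) x y z z.
by transfer (Imp (Rel [set w | A [tuple tnth w 0%R]] [tuple v1; v2; v3])
   (Rel A [tuple v1])) x y z z.
Qed.

Lemma star_snd3 (A : set (1.-tuple posN)) x y z :
  star A [tuple y] <-> star [set w | A [tuple tnth w 1%R]] [tuple x; y; z].
Proof.
split.
  by transfer (Imp (Rel A [tuple v2]) (Rel [set w | A [tuple tnth w 1%R]]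
    [tuple v1; v2; v3])) x y z z.
by transfer (Imp (Rel [set w | A [tuple tnth w 1%R]] [tuple v1; v2; v3])
   (Rel A [tuple v2])) x y z z.
Qed.

Lemma star_thd3 (A : set (1.-tuple posN)) x y z :
  star A [tuple z] <-> star [set w | A [tuple tnth w 2%:R%R]] [tuple x; y; z].
Proof.
split.
  by transfer (Imp (Rel A [tuple v3]) (Rel [set w | A [tuple tnth w 2%:R%R]]
    [tuple v1; v2; v3])) x y z z.
by transfer (Imp (Rel [set w | A [tuple tnth w 2%:R%R]] [tuple v1; v2; v3])
   (Rel A [tuple v3])) x y z z.
Qed.

Lemma star_pair3 (A : set (2.-tuple posN)) x y z :
  star A [tuple x; y] <->
  star [set w | A [tuple tnth w 0%R; tnth w 1%R]] [tuple x; y; z].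
Proof.
split.
  by transfer (Imp (Rel A [tuple v1; v2])
    (Rel [set w | A [tuple tnth w 0%R; tnth w 1%R]]
    [tuple v1; v2; v3])) x y z z.
by transfer (Imp (Rel [set w | A [tuple tnth w 0%R; tnth w 1%R]]
   [tuple v1; v2; v3]) (Rel A [tuple v1; v2])) x y z z.
Qed.

(** Saturation realises types in one variable, so a triple is first coded by one positive integer.
    The type of the code uses no parameters, its finite parts are realised by standard codes, and
    the realisation t is decoded by transfer. *)
Lemma star_realize (U : set_system (3.-tuple posN)) : UltraFilter U ->
  exists x y z : X, ultra [tuple x; y; z] = U.
Proof.
move=> UU.
have [code codeI] : exists code : 3.-tuple posN -> posN, injective code.
  exists (fun w => @PosN (choice.pickle w).+1 isT).
  by move=> u v [] /(pcan_inj choice.pickleK).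
pose G := [set f : formula (option (set0 : set X)) |
  exists2 A, U (code @^-1` A) & f = Rel [set w | A (tnth w 0%R)] [tuple None]].
have [|D finD DG|t tG] := @star_saturated X set0 G.
- exact: card_ge0.
- have [n /card_set_bijP[h [hn hI _]]] : exists n, (D #= `I_n)%card.
    exact/finite_setP.
  have UD m : U [set w | forall f, D f -> h f < m ->
      holds standard f (fun=> code w)].
    elim: m => [|m IHm]; first exact: filterE.
    have [[f [Df fm]]|noD] := pselect (exists f, D f /\ h f = m); last first.
      apply: filterS IHm => w IHw f Df; rewrite ltnS leq_eqVlt.
      move=> /orP[/eqP fm|]; first by case: noD; exists f.
      exact: IHw.
    have [A UA fA] := DG _ Df.
    apply: filterS2 IHm UA => w IHw Aw g Dg; rewrite ltnS leq_eqVlt.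
    move=> /orP[/eqP gm|]; last exact: IHw.
    have -> : g = f by apply: hI; rewrite ?inE// gm.
    by rewrite fA /= map_tuple1.
  have UB : U [set w | forall f, D f -> holds standard f (fun=> code w)].
    by apply: filterS (UD n) => w Dw f Df; apply: Dw => //; exact: hn.
  have [w Bw] := filter_ex UB.
  exists (std X (code w)) => f Df.
  have [A UA fA] := DG _ Df.
  have := Bw _ Df; rewrite fA /= !map_tuple1.
  have /= := @std_elementary X (Rel [set w | A (tnth w 0%R)] [tuple code w]).
  by rewrite /standard /= !map_tuple1 => -[+ _].
have {}tG A : U (code @^-1` A) -> star [set w | A (tnth w 0%R)] [tuple t].
  move=> UA; have := tG (Rel [set w | A (tnth w 0%R)] [tuple None]).
  by rewrite /= map_tuple1; apply; exists A.
pose E : set (4.-tuple posN) := [set w |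
  tnth w 0%R = code [tuple tnth w 1%R; tnth w 2%:R%R; tnth w 3%:R%R]].
have [x [y [z Ex]]] : exists x y z, star E [tuple t; x; y; z].
  have : holds (@star X) (Ex (Ex (Ex (Rel E [tuple Some (Some (Some v1));
      Some (Some None); Some None; None]))))
      (oapp (oapp (oapp (oapp (std X) t) t) t) t).
    (* The transferred sentence: every element of the range of [code] is the code of some triple. *)
    have := @transfer_All X
      (Imp (Rel [set w | range code (tnth w 0%R)] [tuple v1])
      (Ex (Ex (Ex (Rel E [tuple Some (Some (Some v1)); Some (Some None);
       Some None; None]))))) _ t t t t.
    rewrite holds_Imp; apply => [p q r s|].
      rewrite holds_Imp /= map_tuple1 /standard /= => -[w _ wp].
      have {wp} <- : code w = p by rewrite wp.
      exists (tnth w 0%R), (tnth w 1%R), (tnth w 2%:R%R).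
      rewrite /= map_tuple4 /E /=; congr code; apply: eq_from_tnth => k.
      by case: k => -[|[|[|//]]] /= ?; rewrite !(tnth_nth q).
    rewrite /= map_tuple1; apply: (tG (range code)).
    by apply: filterE => w /=; exists w.
  by move=> [x [y [z]]]; rewrite /= map_tuple4 => Ex; exists x, y, z.
exists x, y, z.
(* U being maximal, its inclusion in the ultrafilter of (x, y, z) suffices. *)
apply: max_filter; first by have [] := ultra_UltraFilter x y z.
move=> A UA.
have {}tG : star [set w | (code @` A) (tnth w 0%R)] [tuple t].
  by apply: tG; apply: filterS UA => w Aw; exists w.
move: Ex tG; rewrite /ultra /=.
transfer (Imp (Rel E [tuple v1; v2; v3; v4]) (Imp
  (Rel [set w | (code @` A) (tnth w 0%R)] [tuple v1])
  (Rel A [tuple v2; v3; v4]))) t x y z.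
move=> pE [w Aw wp]; rewrite -(codeI w [tuple q; r; s])//.
by rewrite [LHS]wp [LHS]pE.
Qed.
End Ultra.

(** * Idempotent ultrafilters *)

Definition unbounded (H : set nat) := forall m, exists2 h, H h & m < h.

Lemma unbounded_infinite (H : set nat) : unbounded H <-> infinite_set H.
Proof.
split=> [unbH /finite_seqP[s Hs]|infH m].
  have [h Hh] := unbH (\max_(i <- s) i).
  by rewrite ltnNge leq_bigmax_seq//; move: Hh; rewrite Hs.
apply: contrapT => Hm; apply: infH; apply: (@sub_finite_set _ _ `I_m.+1).
  by move=> h Hh /=; rewrite ltnS leqNgt; apply/negP => mh; apply: Hm; exists h.
exact: finite_II.
Qed.

(* H is built greedily: h belongs to it iff v (A h) holds, and A i h for all
   smaller members i. *)
Lemma tensor_homogeneous (v : set_system nat) {PF : ProperFilter v}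
    (A : nat -> nat -> Prop) :
  \oo `<=` v -> v [set i | v (A i)] ->
  exists H : set nat, unbounded H /\ forall i j, H i -> H j -> i < j -> A i j.
Proof.
move=> v_oo vA.
pose fix below n : seq nat := if n is m.+1 then
  if `[< v (A m) /\ forall i, i \in below m -> A i m >] then rcons (below m) m
  else below m else [::].
have below_lt n i : i \in below n -> i < n.
  elim: n => //= n IHn; case: ifP => _; last by move=> /IHn/ltnW.
  by rewrite mem_rcons inE => /orP[/eqP->//|/IHn/ltnW].
have belowS n i : i < n -> i \in below n -> i \in below i.+1.
  elim: n => // n IHn; rewrite ltnS leq_eqVlt => /orP[/eqP->//|ltin] /=.
  case: ifP => _; last exact: IHn.
  rewrite mem_rcons inE => /orP[/eqP ein|]; last exact: IHn.
  by rewrite ein ltnn in ltin.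
have below_mono n m i : n <= m -> i \in below n -> i \in below m.
  move=> /subnK <-; elim: (m - n)%N => //= k IHk /IHk ink.
  by case: ifP; rewrite // mem_rcons inE ink orbT.
have belowP i :
    i \in below i.+1 <-> v (A i) /\ forall k, k \in below i -> A k i.
  rewrite /=; case: ifP => [/asboolP h|/asboolPn h].
    by rewrite mem_rcons mem_head.
  by split=> // /below_lt; rewrite ltnn.
exists [set i | i \in below i.+1].
split=> [m|i j /= iH /belowP[_ jH] ij]; last first.
  by apply: jH; exact: (below_mono _ _ _ ij iH).
apply: contrapT => noH.
(* With no member above m, [below m.+1] lists all of H, and v-almost every h satisfies A i h for
   each i in it. Such an h above m with v (A h) would itself be a member. *)
have vm : v [set h | forall i, i \in below m.+1 -> A i h].
  have : forall i, i \in below m.+1 -> v (A i).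
    by move=> i im; have /belowP[] := belowS _ _ (below_lt _ _ im) im.
  elim: (below m.+1) => [_|i s IHs vs]; first exact: filterE.
  have vi := vs i (mem_head _ _).
  have /IHs IHv : forall i, i \in s -> v (A i).
    by move=> k ks; apply: vs; rewrite inE ks orbT.
  apply: filterS2 vi IHv => h Aih IH k; rewrite inE => /orP[/eqP->//|].
  exact: IH.
have : v [set h | m < h] by apply: v_oo; exists m.+1.
move=> /(filterI vA)/(filterI vm)/filter_ex[h [hm [vh mh]]].
apply: (noH); exists h => //; apply/belowP; split=> // i ih; apply: hm.
have ii := belowS _ _ (below_lt _ _ ih) ih.
apply: (below_mono _ _ _ _ ii); rewrite ltnS leqNgt; apply/negP => mi.
by apply: noH; exists i.
Qed.

(** The convolution of ultrafilters on (N, +), image of the tensor product under addition, written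
    for arbitrary set systems. *)
Definition tensor (u v : set_system nat) : set_system nat :=
  [set A | u [set i | v [set j | A (i + j)]]].

(** The ultrafilters containing such a u form a closed subsemigroup of the nonprincipal ones, so
    maximal additive filters replace minimal closed subsemigroups. For an ultrafilter the last
    inclusion is idempotence. *)
Definition additive (u : set_system nat) :=
  [/\ ProperFilter u, \oo `<=` u & u `<=` tensor u u].

Lemma tensor_filter (u v : set_system nat) :
  ProperFilter u -> ProperFilter v -> ProperFilter (tensor u v).
Proof.
move=> PU PV; split.
  by move=> uv0; have [i vi] := @filter_ex _ u _ _ uv0; have [] := filter_ex vi.
split=> [|A B|A B AB]; rewrite /tensor /=.
- by apply: filterE => i; exact: filterE.
- by apply: filterS2 => i; exact: filterI.
- by apply: filterS => i; apply: filterS => j; exact: AB.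
Qed.

(** Associativity of addition; this makes [tensor F u] a competitor of a maximal F. *)
Lemma tensor_additive (u v : set_system nat) :
  additive u -> ProperFilter v -> u `<=` v -> additive (tensor u v).
Proof.
move=> [PU u_oo uu] PV uv.
have sub : u `<=` tensor u v.
  by move=> A /uu; rewrite /tensor /=; apply: filterS => i; exact: uv.
split; [exact: tensor_filter|by move=> A /u_oo/sub|].
move=> A uA; apply: sub; have := uu _ uA; rewrite /tensor /=.
apply: filterS => i; apply: filterS => k; apply: filterS => l.
by rewrite /= addnA.
Qed.

Lemma additive_maximal : exists2 u, additive u &
  forall v, additive v -> u `<=` v -> v = u.
Proof.
have [|u [[->|addu] umax]] :=
    @Zorn_bigcup _ [set u : set_system nat | u = set0 \/ additive u].
- move=> C CP Ctot.
  have [[u Cu addu]|noC] := pselect (exists2 u, C u & additive u); last first.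
    left; apply/seteqP; split=> // A [u Cu uA].
    case: (CP _ Cu) uA => [->//|addu]; by case: noC; exists u.
  right.
  have join A B : (\bigcup_(u in C) u) A -> (\bigcup_(u in C) u) B ->
      exists2 u, C u /\ additive u & u A /\ u B.
    move=> [u1 Cu1 u1A] [u2 Cu2 u2B].
    have add1 : additive u1 by case: (CP _ Cu1) u1A => [->|].
    have add2 : additive u2 by case: (CP _ Cu2) u2B => [->|].
    by case: (Ctot _ _ Cu1 Cu2) => sub; [exists u2|exists u1] => //; split=> //;
      exact: sub.
  split.
  + split.
      move=> [w Cw w0]; case: (CP _ Cw) w0 => [->//|[Pw _ _]].
      exact: filter_not_empty.
    split.
    * by exists u => //; case: addu => *; exact: filterT.
    * move=> A B Aw Bw; have [w [Cw [Pw _ _]] [wA wB]] := join _ _ Aw Bw.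
      by exists w => //; exact: filterI.
    * move=> A B AB Aw; have [w [Cw [Pw _ _]] [wA _]] := join _ _ Aw Aw.
      by exists w => //; exact: filterS wA.
  + by move=> A oA; exists u => //; case: addu => _ + _; exact.
  + move=> A Aw; have [w [Cw [Pw w_oo ww]] [wA _]] := join _ _ Aw Aw.
    exists w => //; have := ww _ wA; rewrite /tensor /=; apply: filterS => i wi.
    by exists w.
- have addoo : additive \oo.
    split; [exact: eventually_filter|by []|move=> A [N _ NA]].
    rewrite /tensor /=; apply: filterE => i.
    by exists N => // j /= Nj; apply: NA => /=; exact: leq_trans (leq_addl _ _).
  case: (umax \oo _ _); last by right.
  split=> // /(_ setT) /= oo0; apply: oo0; exact: filterT.
- exists u => // v addv uv; apply: contrapT => vu.
  by apply: (umax v); [split=> // vu'; apply: vu; exact/seteqP|right].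
Qed.

(* Ellis-Numakura for filters: if F is maximal additive then tensor F u = F for
   every ultrafilter u containing F, and the filter H generated by F and by the
   sets [set i | u [set j | A (i + j)]] for A in u is additive, hence equal to
   F; this says that u is contained in tensor F u = F. *)
Lemma exists_idempotent : exists2 u, UltraFilter u & additive u.
Proof.
have [F addF Fmax] := additive_maximal.
have [PF F_oo FF] := addF.
have [u [UU Fu]] := ultraFilterLemma PF.
have FuF : tensor F u = F.
  apply: Fmax; first exact: tensor_additive.
  by move=> A /FF; rewrite /tensor /=; apply: filterS => i; exact: Fu.
pose H : set_system nat := [set D | exists C A,
  [/\ F C, u A & C `&` [set i | u [set j | A (i + j)]] `<=` D]].
have FH : F `<=` H.
  by move=> C FC; exists C, setT; split; [by []|exact: filterT|move=> i []].
have HF : H = F.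
  apply: Fmax => //; split.
  - split.
      (* If the intersection were empty, C would put the complement of A in [tensor F u] = F, hence
         in u, which contains A. *)
      move=> [C [A [FC uA CA]]].
      have : tensor F u (~` A).
        rewrite /tensor /=; apply: filterS FC => i Ci.
        have [|//] := in_ultra_setVsetC [set j | A (i + j)] UU.
        by move=> uAi; case: (CA i).
      rewrite FuF => /Fu uAC; apply: (@filter_not_empty _ u).
      by rewrite -(setICr A); exact: filterI.
    split; first by apply: FH; exact: filterT.
    + move=> D1 D2 [C1 [A1 [FC1 uA1 D1s]]] [C2 [A2 [FC2 uA2 D2s]]].
      exists (C1 `&` C2), (A1 `&` A2).
      split; [exact: filterI|exact: filterI|].
      move=> i [[C1i C2i] uA]; split; [apply: D1s|apply: D2s]; split=> //=;
        by apply: filterS uA => j [].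
    + move=> D1 D2 sub [C [A [FC uA D1s]]]; exists C, A.
      by split=> // i /D1s/sub.
  - by move=> A /F_oo/FH.
  - move=> D [C [A [FC uA Ds]]].
    exists [set i | F [set j | C (i + j)]], A.
    split=> //; first exact: (FF _ FC).
    move=> i /= [FCi uAi]; exists [set j | C (i + j)], [set j | A (i + j)].
    split=> // j [Cij uAij]; apply: Ds; split=> //.
    by apply: filterS uAij => k /=; rewrite addnA.
exists u => //; suff -> : u = F by [].
apply/seteqP; split=> // A uA; rewrite -FuF /tensor /= -HF.
by exists setT, A; split; [exact: filterT|by []|move=> i []].
Qed.

(** * Ramsey triples *)

(* x, y, z are read as random variables on T, the elements of F being the events
   of probability 1: they stand for alpha, beta, gamma, with T = posN^3 and
   F = u(alpha, beta, gamma) in one direction of the theorem. *)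
Record ramsey_triple T (F : set_system T) (x y z : T -> nat) : Prop :=
  RamseyTriple {
    triple_gt0 : F [set w | 0 < x w];
    triple_xy : forall A : set nat, F [set w | A (x w)] <-> F [set w | A (y w)];
    triple_yz : forall A : set nat, F [set w | A (y w)] <-> F [set w | A (z w)];
    triple_ramsey : forall A : nat -> nat -> Prop, F [set w | A (x w) (y w)] ->
      exists H : set nat,
        unbounded H /\ forall i j, H i -> H j -> i < j -> A i j }.

(** * Passage between nonstandard points and Ramsey triples *)

Section Realization.

Variable X : nonstandard_extension.

Lemma equiE (x y : X) : equi x y <->
  forall A : set posN, star [set w | A (tnth w 0%R)] [tuple x] <->
                       star [set w | A (tnth w 0%R)] [tuple y].
Proof.
split=> [xy A|xy].
  have := congr1 (fun U : set_system (1.-tuple posN) =>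
    U [set w | A (tnth w 0%R)]) xy.
  by rewrite /ultra /= => ->.
apply/seteqP; split=> A; rewrite /ultra /= => Ax;
  have := xy [set p | A [tuple p]];
  have -> : [set w : 1.-tuple posN | [set p | A [tuple p]] (tnth w 0%R)] = A.
- by apply/seteqP; split=> w /=; rewrite (_ : [tuple tnth w 0%R] = w)//;
    apply: eq_from_tnth => i; rewrite !ord1.
- by move=> -[+ _]; apply.
- by apply/seteqP; split=> w /=; rewrite (_ : [tuple tnth w 0%R] = w)//;
    apply: eq_from_tnth => i; rewrite !ord1.
- by move=> -[_]; apply.
Qed.

Lemma nonstandard_triple (a b c : X) :
  equi a b -> equi b c -> ramsey_pair a b ->
  ramsey_triple (ultra [tuple a; b; c]) (fun w => tnth w 0%R : nat)
    (fun w => tnth w 1%R : nat) (fun w => tnth w 2%:R%R : nat).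
Proof.
move=> /equiE ab /equiE bc [_ Rab].
have U := ultra_UltraFilter a b c.
split.
- by apply: filterE => w; exact: posN_gt0.
- move=> A; have := ab [set p : posN | A p].
  by rewrite (star_fst3 _ a b c) (star_snd3 _ a b c).
- move=> A; have := bc [set p : posN | A p].
  by rewrite (star_snd3 _ a b c) (star_thd3 _ a b c).
- move=> A FA.
  have [|H [infH HA]] :=
      Rab [set p : 2.-tuple posN | A (tnth p 0%R) (tnth p 1%R)].
    by rewrite /ultra /=; apply/(star_pair3 _ a b c).
  exists [set (h : nat) | h in H]; split => /=.
    apply/unbounded_infinite => finH; apply: infH.
    apply: sub_finite_set (finite_preimage (f := posN_val) _ finH).
      by move=> h Hh; exists h.
    by move=> p q _ _; exact: val_inj.
  move=> _ _ [i Hi <-] [j Hj <-] ij.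
  exact: (HA [tuple i; j]).
Qed.

Lemma triple_nonstandard (P : nat -> nat -> nat -> Prop) T
    (F : set_system T) (x y z : T -> nat) : UltraFilter F ->
  ramsey_triple F x y z -> F [set w | P (x w) (y w) (z w)] ->
  exists a b c : X,
    [/\ equi a b, equi b c, ramsey_pair a b &
      star [set w : 3.-tuple posN |
        P (tnth w 0%R) (tnth w 1%R) (tnth w 2%:R%R)] [tuple a; b; c]].
Proof.
move=> UF [x_gt0 xy yz Rxy] FP.
have y_gt0 : F [set w | 0 < y w] by apply/(xy [set n | 0 < n]).
have z_gt0 : F [set w | 0 < z w] by apply/(yz [set n | 0 < n]).
(* [pos] sends 0 to 1; the three values are F-almost surely positive, so the equation P is not
   affected by this default. *)
pose pos n := @PosN n.-1.+1 isT.
have posK (p : posN) : pos p = p.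
  by apply: val_inj => /=; rewrite prednK// posN_gt0.
pose f w := [tuple pos (x w); pos (y w); pos (z w)].
have [a [b [c abc]]] := star_realize X (ultra_fmap f UF).
have starE A : star A [tuple a; b; c] <-> F [set w | A (f w)].
  by rewrite -[star _ _]/(ultra _ _) abc.
exists a, b, c; split.
- apply/equiE => A; rewrite (star_fst3 _ a b c) (star_snd3 _ a b c) !starE.
  exact: (xy [set n | A (pos n)]).
- apply/equiE => A; rewrite (star_snd3 _ a b c) (star_thd3 _ a b c) !starE.
  exact: (yz [set n | A (pos n)]).
- have ultraE : ultra [tuple a; b] =
      [set A | F [set w | A [tuple pos (x w); pos (y w)]]].
    apply/seteqP; split=> A; rewrite /ultra /=.
      by rewrite (star_pair3 _ a b c) starE.
    by rewrite (star_pair3 _ a b c) starE.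
  split; first by rewrite ultraE; exact: ultra_fmap.
  rewrite ultraE => A /= /(Rxy (fun i j => A [tuple pos i; pos j])).
  move=> [H [unbH HA]]; exists [set p : posN | H p]; split.
    move=> /(finite_image (fun p : posN => p : nat)).
    apply/unbounded_infinite => m.
    have [h Hh mh] := unbH m; exists h => //; exists (pos h) => /=;
      by rewrite prednK//; apply: leq_ltn_trans mh.
  move=> p [/= Hp Hq pq]; have := HA _ _ Hp Hq pq; rewrite !posK.
  congr A; apply: eq_from_tnth => i; case: i => -[|[|//]] i2;
    by rewrite !(tnth_nth (pos 0)).
- apply/starE; apply: filterS2 FP (filterI x_gt0 (filterI y_gt0 z_gt0)).
  by move=> w Pw [? [? ?]]; rewrite /= !prednK.
Qed.

End Realization.

(** * Triples for the two solvable equations *)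

Lemma ultra_prod T U (F : set_system T) (G : set_system U) :
  UltraFilter F -> UltraFilter G ->
  UltraFilter [set A : set (T * U) | F [set i | G [set j | A (i, j)]]].
Proof.
move=> UF UG; apply: UltraFilter_setC => [|A]; last first.
  have [h|h] := in_ultra_setVsetC [set i | G [set j | A (i, j)]] UF.
    by left.
  right; apply: filterS h => i nGi.
  by have [//|] := in_ultra_setVsetC [set j | A (i, j)] UG.
split.
  move=> F0; have [i Gi] := @filter_ex _ F _ _ F0.
  by have [] := filter_ex Gi.
split=> [|A B|A B AB] /=.
- by apply: filterE => i; exact: filterE.
- by apply: filterS2 => i; exact: filterI.
- by apply: filterS => i; apply: filterS => j; exact: AB.
Qed.

Lemma filter_cstE T (F : set_system T) (P : Prop) :
  ProperFilter F -> F [set _ | P] = P.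
Proof.
by move=> PF; apply/propext; split=> [/filter_const//|p]; exact: filterE.
Qed.

(** All three marginals are u: the third is [tensor u u], equal to u because u is a maximal filter
    contained in it. *)
Lemma sum_triple : exists F : set_system (nat * nat),
  exists x y z : nat * nat -> nat, [/\ UltraFilter F, ramsey_triple F x y z
    & F [set w | x w + y w = z w]].
Proof.
have [u Uu [Pu u_oo uu]] := exists_idempotent.
exists [set A | u [set i | u [set j | A (i, j)]]].
have cst (P : Prop) : u [set _ | P] = P by exact: filter_cstE.
exists fst, snd, (fun w => w.1 + w.2); split; first exact: ultra_prod.
  split=> [|A|A|A] /=.
  - rewrite (_ : (fun i => u [set _ | 0 < i]) = [set i | 0 < i]).
      by apply: u_oo; exists 1.
    by apply/funext => i; exact: cst.
  - rewrite cst (_ : (fun i => u [set _ | A i]) = A)//.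
    by apply/funext => i; exact: cst.
  - rewrite cst; have : tensor u u = u.
      by apply: max_filter => //; exact: tensor_filter.
    by move/(congr1 (fun U : set_system nat => U A)) => <-.
  - by move=> /(tensor_homogeneous u_oo).
by have UF := ultra_prod Uu Uu; exact: filterE.
Qed.

(** Each of the three differences has the law [D] of j - i under the tensor square. Truncated
    subtraction is harmless since i < j < k almost surely. *)
Lemma difference_triple : exists F : set_system (nat * (nat * nat)),
  exists x y z : nat * (nat * nat) -> nat,
  [/\ UltraFilter F, ramsey_triple F x y z & F [set w | x w + z w = y w]].
Proof.
have [u Uu [Pu u_oo uu]] := exists_idempotent.
exists [set A | u [set i | u [set j | u [set k | A (i, (j, k))]]]].
exists (fun w => w.2.1 - w.1), (fun w => w.2.2 - w.1), (fun w => w.2.2 - w.2.1).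
have gtE m : u [set i | m < i] by apply: u_oo; exists m.+1.
pose D A := u [set i | u [set j | A (j - i)]].
have cst (P : Prop) : u [set _ | P] = P by exact: filter_cstE.
have xE A : u [set i | u [set j | u [set k | A (j - i)]]] = D A.
  by congr u; apply/funext => i; congr u; apply/funext => j; rewrite /= cst.
have yE A : u [set i | u [set j | u [set k | A (k - i)]]] = D A.
  by congr u; apply/funext => i; rewrite /= cst.
have zE A : u [set i | u [set j | u [set k | A (k - j)]]] = D A.
  by rewrite cst.
split.
- exact: (ultra_prod Uu (ultra_prod Uu Uu)).
- split=> [|A|A|A] /=.
  + rewrite (xE [set n | 0 < n]) /D; apply: filterE => i.
    by apply: filterS (gtE i) => j /=; rewrite subn_gt0.
  + by rewrite xE yE.
  + by rewrite yE zE.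
  (* For a fixed generic i, the pair (j, k) follows a tensor square; a homogeneous set K for the
     condition on (j - i, k - i) is then translated down by i. *)
  + move=> uA; have [i uAi] := @filter_ex _ u _ _ uA.
    have [K [unbK KA]] := tensor_homogeneous u_oo uAi.
    exists [set h | K (h + i)]; split=> [m|h h' Kh Kh' hh'].
      have [k Kk mk] := unbK (m + i); exists (k - i);
        last by rewrite ltn_subRL addnC.
      by rewrite /= subnK//; apply: leq_trans (ltnW mk); exact: leq_addl.
    by have := KA _ _ Kh Kh'; rewrite /= ltn_add2r !addnK; apply.
- rewrite /=; apply: filterE => i; apply: filterS (gtE i) => j /= ij.
  apply: filterS (gtE j) => k /= jk; lia.
Qed.

(** * Integer polynomials *)

Section IntegerPolynomials.

Local Open Scope ring_scope.

Implicit Types R : {poly int}.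

Lemma lead_coef_MXaddC R (c : int) :
  R != 0 -> lead_coef (R * 'X + c%:P) = lead_coef R.
Proof.
move=> R0; rewrite lead_coefDl ?lead_coefMX// size_mulX// ltnS.
by rewrite (leq_trans (size_polyC_leq1 _))// size_poly_gt0.
Qed.

Lemma poly_eventually_ge1 R : 0 < lead_coef R ->
  exists N : nat, forall k : nat, (N <= k)%N -> 1 <= R.[k%:Z].
Proof.
elim/poly_ind: R => [|R c IHR]; first by rewrite lead_coef0.
have [->|R0] := eqVneq R 0.
  rewrite mul0r add0r lead_coefC => c0; exists 0%N => k _.
  by rewrite hornerC; lia.
rewrite lead_coef_MXaddC// => /IHR[N RN].
exists (maxn N `|c|.+1) => k; rewrite geq_max => /andP[/RN Rk ck].
rewrite !hornerE; move: R.[k%:Z] Rk => u u1.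
have : k%:Z <= u * k%:Z by nia.
lia.
Qed.

(** The increment of R X + c at k is k (R(k+1) - R(k)) + R(k+1), where R is eventually positive and
    nondecreasing. In [poly_eventually_steep] R is strictly increasing, which gains the term k. *)
Lemma poly_eventually_incr R : 0 < lead_coef R -> (1 < size R)%N ->
  exists N : nat, forall k : nat, (N <= k)%N -> R.[k%:Z] + 1 <= R.[k.+1%:Z].
Proof.
elim/poly_ind: R => [|R c IHR]; first by rewrite lead_coef0.
have [->|R0] := eqVneq R 0.
  by rewrite mul0r add0r size_polyC; case: (c == 0).
rewrite lead_coef_MXaddC// => Rgt0 _.
have [N RN] := poly_eventually_ge1 Rgt0.
have [N' RN'] : exists N : nat, forall k : nat, (N <= k)%N ->
    R.[k%:Z] <= R.[k.+1%:Z].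
  have [/IHR|/size1_polyC ->] := ltnP 1 (size R); last first.
    by exists 0%N => k _; rewrite !hornerC.
  by move=> /(_ Rgt0)[M RM]; exists M => k /RM; lia.
exists (maxn N N') => k; rewrite geq_max => /andP[Nk /RN' Rk].
have := RN k.+1 (leqW Nk); rewrite !hornerE.
move: R.[k.+1%:Z] R.[k%:Z] Rk => u v uv u1.
have -> : k.+1%:Z = k%:Z + 1 by lia.
by nia.
Qed.

Lemma poly_eventually_steep R : 0 < lead_coef R -> (2 < size R)%N ->
  exists N : nat, forall k : nat, (N <= k)%N -> R.[k%:Z] + k%:Z <= R.[k.+1%:Z].
Proof.
elim/poly_ind: R => [|R c _]; first by rewrite lead_coef0.
have [->|R0] := eqVneq R 0.
  by rewrite mul0r add0r size_polyC; case: (c == 0).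
rewrite lead_coef_MXaddC// size_MXaddC (negPf R0) /= ltnS => Rgt0 sR.
have [N RN] := poly_eventually_ge1 Rgt0.
have [N' RN'] := poly_eventually_incr Rgt0 sR.
exists (maxn N N') => k; rewrite geq_max => /andP[Nk /RN' Rk].
have := RN k.+1 (leqW Nk); rewrite !hornerE.
move: R.[k.+1%:Z] R.[k%:Z] Rk => u v uv u1.
have -> : k.+1%:Z = k%:Z + 1 by lia.
by nia.
Qed.

Lemma poly_norm_unbounded R : (1 < size R)%N -> forall m : nat,
  exists N : nat, forall k : nat, (N <= k)%N -> m%:Z <= `|R.[k%:Z]|.
Proof.
wlog Rgt0 : R / 0 < lead_coef R => [hw sR|].
  have R0 : R != 0 by rewrite -size_poly_gt0; apply: leq_trans sR.
  have [/hw/(_ sR)//|] := ltrP 0 (lead_coef R).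
  rewrite le_eqVlt lead_coef_eq0 (negPf R0) -oppr_gt0 -lead_coefN /=.
  move=> /hw; rewrite size_polyN => /(_ sR) {}hw m.
  by have [N RN] := hw m; exists N => k /RN; rewrite hornerN normrN.
move=> sR m; have [N RN] := poly_eventually_incr Rgt0 sR.
exists (N + m + `|R.[N%:Z]|)%N => k Nk.
have Rk j : R.[N%:Z] + j%:Z <= R.[(N + j)%N%:Z].
  elim: j => [|j IHj]; first by rewrite addn0 addr0.
  have := RN (N + j)%N (leq_addr _ _); rewrite addnS; lia.
by have := Rk (k - N)%N; rewrite subnKC; lia.
Qed.

(** Beyond N2 consecutive values are more than m apart. A smaller k' is excluded because |R(k)|
    outgrows m plus the sum of the finitely many |R(i)| with i < N2. *)
Lemma poly_values_isolated R : (2 < size R)%N -> forall m : nat,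
  exists N : nat, forall k : nat, (N <= k)%N -> forall k' : nat,
    `|R.[k'%:Z] - R.[k%:Z]| <= m%:Z -> k' = k.
Proof.
wlog Rgt0 : R / 0 < lead_coef R => [hw sR|].
  have R0 : R != 0 by rewrite -size_poly_gt0; apply: leq_trans sR.
  have [/hw/(_ sR)//|] := ltrP 0 (lead_coef R).
  rewrite le_eqVlt lead_coef_eq0 (negPf R0) -oppr_gt0 -lead_coefN /=.
  move=> /hw; rewrite size_polyN => /(_ sR) {}hw m.
  have [N RN] := hw m; exists N => k /RN + k' => /(_ k').
  by rewrite !hornerN -opprD normrN.
move=> sR m; have [N1 RN1] := poly_eventually_steep Rgt0 sR.
pose N2 := (N1 + m.+1)%N.
have RN2 k k' : (N2 <= k < k')%N -> m%:Z < R.[k'%:Z] - R.[k%:Z].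
  move=> /andP[Nk]; elim: k' => // k' IHk'; rewrite ltnS leq_eqVlt.
  have N1k : (N1 <= k)%N by apply: leq_trans Nk; exact: leq_addr.
  have mk : (m < k)%N by apply: leq_trans Nk; exact: leq_addl.
  move=> /orP[/eqP<-|kk']; first by have := RN1 _ N1k; lia.
  have := RN1 k' (leq_trans N1k (ltnW kk')); have := IHk' kk'; lia.
have [N RN] := @poly_norm_unbounded R (ltnW sR)
  (m + \sum_(i < N2) `|R.[i%:Z]|).+1%N.
exists (maxn N N2) => k; rewrite geq_max => /andP[Nk N2k] k'.
have [N2k'|k'N2] := leqP N2 k'; last first.
  have := RN k Nk; rewrite (bigD1 (Ordinal k'N2))//= => h1 h2; lia.
have [kk'|kk'|//] := ltngtP k' k.
- by have := RN2 k' k; rewrite N2k' kk' => /(_ isT); lia.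
- by have := RN2 k k'; rewrite N2k kk' => /(_ isT); lia.
Qed.

Lemma poly_superlinear R : R.[0] = 0 -> (2 < size R)%N -> forall c : nat,
  exists N : nat, forall k : nat, (N <= k)%N -> (c * k)%N%:Z <= `|R.[k%:Z]|.
Proof.
elim/poly_ind: R => [|R c _]; first by rewrite size_poly0.
rewrite hornerMXaddC mulr0 add0r => ->; rewrite addr0.
have [->|R0] := eqVneq R 0; first by rewrite mul0r size_poly0.
rewrite size_mulX// ltnS => sR m; have [N RN] := poly_norm_unbounded sR m.
exists N => k /RN Rk; rewrite hornerMX normrM PoszM.
by rewrite [`|k%:Z|]ger0_norm// ler_wpM2r.
Qed.

Lemma poly_size_gt1 R : R != 0 -> R.[0] = 0 -> (1 < size R)%N.
Proof.
move=> R0 R00; rewrite ltnNge; apply: contra R0 => /size1_polyC RC.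
by move: R00; rewrite RC hornerC => ->.
Qed.

Lemma poly_linear R : R.[0] = 0 -> (size R <= 2)%N -> R = R`_1 *: 'X.
Proof.
move=> R0 sR; apply/polyP => -[|[|i]]; rewrite coefZ coefX /=.
- by rewrite mulr0 -horner_coef0.
- by rewrite mulr1.
- by rewrite mulr0 nth_default// (leq_trans sR).
Qed.

End IntegerPolynomials.

(** * Digits in a prime base *)

Section DigitAnalysis.

Variables (l a n : nat) (p : int) (x y z : nat).
Hypotheses (l_prime : prime l) (apl : a + `|p| < l).
Hypotheses (a_gt0 : 0 < a) (p_neq0 : p != 0%R) (n_gt0 : 0 < n).
Hypotheses (x_gt0 : 0 < x) (y_gt0 : 0 < y) (z_gt0 : 0 < z).
Hypothesis xyz : ((a * x ^ n)%N%:Z + p * y%:Z = p * z%:Z)%R.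

Let v t := logn l t.

Let dvd_v k t : 0 < t -> (l ^ k %| t) = (k <= v t).
Proof. by move=> t0; rewrite pfactor_dvdn. Qed.

Let p_coprime k : coprime (l ^ k) `|p|.
Proof.
apply: coprimeXl; rewrite prime_coprime//; apply/negP => /dvdn_leq.
by rewrite absz_gt0 p_neq0 => /(_ isT); lia.
Qed.

Let a_coprime k : coprime (l ^ k) a.
Proof.
by apply: coprimeXl; rewrite prime_coprime//; apply/negP => /dvdn_leq; lia.
Qed.

Let dvd_pz k (t : nat) : ((l ^ k)%N%:Z %| (p * t%:Z)%R)%Z = (l ^ k %| t).
Proof. by rewrite dvdzE abszM /= Gauss_dvdr. Qed.

Let dvd_pzy k : ((l ^ k)%N%:Z %| (p * (z%:Z - y%:Z))%R)%Z =
  ((l ^ k)%N%:Z %| (z%:Z - y%:Z)%R)%Z.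
Proof. by rewrite !dvdzE abszM /= Gauss_dvdr. Qed.

Let dvd_ax k : (l ^ k %| a * x ^ n) = (k <= n * v x).
Proof. by rewrite Gauss_dvdr// dvd_v ?expn_gt0 ?x_gt0// /v lognX. Qed.

Let dvd_axz k : ((l ^ k)%N%:Z %| (a * x ^ n)%N%:Z)%Z = (k <= n * v x).
Proof. by rewrite dvdzE /= dvd_ax. Qed.

Definition digit t i := (t %/ l ^ i) %% l.

(** Facts available at almost every point of a Ramsey triple: the first five compare finite
    colorings of two of x, y, z, and the last is the Ramsey dichotomy for [logn l]. *)
Hypothesis yz_mod : y = z %[mod l].
Hypothesis xz_digit : digit x (logn l x) = digit z (logn l z).
Hypothesis yz_lead : digit y (logn l y) = digit z (logn l z).
Hypothesis yz_digit : digit y (n * logn l y) = digit z (n * logn l z).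
Hypothesis xz_log :
  odd (trunc_log n (logn l x)) = odd (trunc_log n (logn l z)).
Hypothesis xy_v : logn l x = logn l y \/ n * logn l x < logn l y.

Let vx_gt0 : 0 < v x.
Proof.
have : (l%:Z %| (a * x ^ n)%N%:Z)%Z.
  have -> : ((a * x ^ n)%N%:Z = p * (z%:Z - y%:Z))%R.
    by rewrite mulrBr -xyz addrK.
  apply: dvdz_mull; rewrite -eqz_mod_dvd.
  by apply/eqP; rewrite !modz_nat yz_mod.
have := dvd_axz 1; rewrite expn1 => ->.
by rewrite muln_gt0 => /andP[].
Qed.

Let dvd_small (q : int) : (l%:Z %| q)%Z -> `|q| < l -> q = 0%R.
Proof.
rewrite dvdzE /= => lq ql; apply/eqP; rewrite -absz_eq0; apply/eqP.
by have [//|q0] := posnP `|q|; have := dvdn_leq q0 lq; lia.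
Qed.

Let lead_coprime t : 0 < t -> coprime l (t %/ l ^ v t).
Proof.
move=> t0; rewrite prime_coprime// dvdn_divRL ?pfactor_dvdnn// -expnS.
by rewrite dvd_v// ltnn.
Qed.

Let expl_neq0 i : ((l ^ i)%N%:Z != 0)%R.
Proof. by rewrite eqz_nat -lt0n expn_gt0 prime_gt0. Qed.

Let cancel (q : int) (t : nat) : coprime l t ->
  (l%:Z %| (q * t%:Z)%R)%Z -> `|q| < l -> q = 0%R.
Proof.
by move=> lt; rewrite dvdzE abszM /= Gauss_dvdl// => lq; exact: dvd_small.
Qed.

Let dvd_sub (s t : nat) : s = t %[mod l] -> (l%:Z %| (s%:Z - t%:Z)%R)%Z.
Proof. by move=> st; rewrite -eqz_mod_dvd; apply/eqP; rewrite !modz_nat st. Qed.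

(** The term p y has too high a valuation to matter, so v(z) = n v(x). If n > 1, the base n
    logarithms of v(z) and v(x) differ by 1, against their equal parity. Once n = 1, the lowest
    nonzero digits give a = p modulo l, and l exceeds |a - p|. *)
Let case_far : n * v x < v y -> n = 1 /\ p = a%:Z%R.
Proof.
move=> xy.
have pyE k : k <= v y -> ((l ^ k)%N%:Z %| (p * y%:Z)%R)%Z.
  by rewrite dvd_pz dvd_v.
have vz : v z = n * v x.
  apply/eqP; rewrite eqn_leq; apply/andP; split; last first.
    by rewrite -dvd_v// -dvd_pz -xyz rpredD ?dvd_axz// pyE// ltnW.
  rewrite leqNgt; apply/negP; rewrite -dvd_v// -dvd_pz -xyz.
  by rewrite rpredDr ?pyE// dvd_axz ltnn.
have n1 : n = 1.
  apply/eqP; rewrite eqn_leq n_gt0 andbT leqNgt; apply/negP => n2.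
  move: xz_log; rewrite -/(v x) -/(v z) vz trunc_logMp//=.
  by case: odd.
split=> //; move: xyz xz_digit xy.
rewrite -/(v x) -/(v z) vz n1 expn1 mul1n /digit.
move=> xyz1 digE xy.
have [y1 yE] : exists y1, y = y1 * (l * l ^ v x).
  by apply/dvdnP; rewrite -expnS dvd_v.
have zE : z = z %/ l ^ v x * l ^ v x.
  by rewrite divnK// dvd_v// vz n1 mul1n.
have xE : x = x %/ l ^ v x * l ^ v x by rewrite divnK// dvd_v.
have x1_coprime := lead_coprime x_gt0.
move: (v x) (x %/ l ^ v x) (z %/ l ^ v x) xE zE digE x1_coprime yE.
move=> i x1 z1 xE zE digE x1_coprime yE.
have eq1 : (a%:Z * x1%:Z + p * (y1%:Z * l%:Z) = p * z1%:Z)%R.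
  apply: (mulIf (expl_neq0 i)).
  by move: xyz1; rewrite xE zE yE !PoszM => e; rewrite -[RHS]mulrA -e; ring.
apply/eqP; rewrite eq_sym -subr_eq0; apply/eqP.
apply: (cancel x1_coprime); last by move: apl; clear; lia.
have -> : ((a%:Z - p) * x1%:Z = p * (z1%:Z - x1%:Z) - p * (y1%:Z * l%:Z))%R.
  by rewrite [in RHS]mulrBr -eq1; ring.
rewrite rpredB//; first by apply: dvdz_mull; exact: dvd_sub.
by apply: dvdz_mull; apply: dvdz_mull.
Qed.

(** If v(z) <= v(x), then v(z) = v(x), and z - y has valuation exactly n v(x): y and z first differ
    at that digit, against [yz_digit]. So v(z) > v(x); then n > 1 would make p y divisible by a
    higher power of l than y is. Once n = 1, the lowest nonzero digits give a + p = 0 modulo l. *)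
Let case_near : v x = v y -> n = 1 /\ p = (- a%:Z)%R.
Proof.
move=> xy.
have pzy : (p * (z%:Z - y%:Z) = (a * x ^ n)%N%:Z)%R.
  by rewrite mulrBr -xyz addrK.
have [vz|vz] := leqP (v z) (v x).
  exfalso.
  have {}vz : v z = v x.
    apply/eqP; rewrite eqn_leq vz -dvd_v// -dvd_pz -xyz rpredD//.
      by rewrite dvd_axz leq_pmull.
    by rewrite dvd_pz dvd_v// xy.
  move: yz_digit; rewrite -/(v y) -/(v z) vz -xy /digit.
  have : ((l ^ (n * v x))%N%:Z %| (p * (z%:Z - y%:Z))%R)%Z.
    by rewrite pzy dvd_axz.
  have : ~~ ((l ^ (n * v x).+1)%N%:Z %| (p * (z%:Z - y%:Z))%R)%Z.
    by rewrite pzy dvd_axz ltnn.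
  rewrite !dvd_pzy; move: (n * v x) => i ndvd dvd dig.
  have ri : y %% l ^ i = z %% l ^ i.
    by move: dvd; rewrite -eqz_mod_dvd !modz_nat => /eqP[].
  move: ndvd; rewrite (divn_eq y (l ^ i)) (divn_eq z (l ^ i)) ri.
  move/dvd_sub: (esym dig); move: (y %/ l ^ i) (z %/ l ^ i) => y1 z1 lzy.
  have -> : ((z1 * l ^ i + z %% l ^ i)%N%:Z - (y1 * l ^ i + z %% l ^ i)%N%:Z
    = (z1%:Z - y1%:Z) * (l ^ i)%N%:Z)%R by rewrite !PoszD !PoszM; ring.
  by rewrite expnS PoszM dvdz_mul.
have [n2|n1] := ltnP 1 n.
  exfalso; suff : v x < v y by rewrite xy ltnn.
  have le_n : (v x).+1 <= n * v x by move: n2 vx_gt0; nia.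
  rewrite -dvd_v// -dvd_pz.
  have -> : (p * y%:Z = p * z%:Z - (a * x ^ n)%N%:Z)%R by rewrite -xyz; ring.
  by rewrite rpredB ?dvd_axz// dvd_pz dvd_v.
have {n1} n1 : n = 1 by apply/eqP; rewrite eqn_leq n1.
split=> //; move: xyz; rewrite n1 expn1 => xyz1.
have xy_digit : x %/ l ^ v x = y %/ l ^ v x %[mod l].
  by rewrite -/(digit x (v x)) -/(digit y (v x)) {2}xy yz_lead -xz_digit.
have [z1 zE] : exists z1, z = z1 * (l * l ^ v x).
  by apply/dvdnP; rewrite -expnS dvd_v.
have yE : y = y %/ l ^ v x * l ^ v x by rewrite divnK// dvd_v// xy.
have xE : x = x %/ l ^ v x * l ^ v x by rewrite divnK// dvd_v.
have x1_coprime := lead_coprime x_gt0.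
move: (v x) (x %/ l ^ v x) (y %/ l ^ v x) xE yE xy_digit x1_coprime zE.
move=> i x1 y1 xE yE xy_digit x1_coprime zE.
have eq1 : (a%:Z * x1%:Z + p * y1%:Z = p * (z1%:Z * l%:Z))%R.
  apply: (mulIf (expl_neq0 i)).
  move: xyz1; rewrite xE zE yE !PoszM => e.
  transitivity (a%:Z * (x1%:Z * (l ^ i)%N%:Z) + p * (y1%:Z * (l ^ i)%N%:Z))%R.
    by ring.
  by rewrite e; ring.
apply/eqP; rewrite -subr_eq0 opprK; apply/eqP.
apply: (cancel x1_coprime); last by move: apl; clear; lia.
have -> : ((p + a%:Z) * x1%:Z = p * (x1%:Z - y1%:Z) + p * (z1%:Z * l%:Z))%R.
  by rewrite -eq1; ring.
rewrite rpredD//; first by apply: dvdz_mull; exact: dvd_sub.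
by apply: dvdz_mull; apply: dvdz_mull.
Qed.

Lemma digit_analysis : n = 1 /\ (p = a%:Z%R \/ p = (- a%:Z)%R).
Proof.
by case: xy_v => [/case_near|/case_far] [-> ->]; split=> //; [right|left].
Qed.

End DigitAnalysis.

(** * The equation on Ramsey triples *)

Lemma finite_image_injective T U (f : T -> U) (A : set T) :
  {in A &, injective f} -> finite_set (f @` A) -> finite_set A.
Proof. by move=> /inj_card_eq/eq_finite_set <-. Qed.

Section RamseyTriple.

Variables (T : Type) (F : set_system T) (x y z : T -> nat).
Hypotheses (UF : UltraFilter F) (RF : ramsey_triple F x y z).

Implicit Types p q : T -> nat.

Definition same_type p q :=
  forall A : set nat, F [set w | A (p w)] <-> F [set w | A (q w)].

(** One of the finitely many colors is taken by p almost surely, hence by q as well. *)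
Lemma same_type_color (f : nat -> nat) K p q : same_type p q ->
  (forall k, f k < K) -> F [set w | f (p w) = f (q w)].
Proof.
move=> pq fK; apply: contrapT => neq.
have [c Fc] : exists c : 'I_K, F [set w | f (p w) = c].
  apply: contrapT => noc.
  have : F [set w | forall c : 'I_K, f (p w) != c].
    apply: filter_forall => c.
    have [h|h] := in_ultra_setVsetC [set w | f (p w) = c] UF.
      by case: noc; exists c.
    by apply: filterS h => w /eqP.
  move=> /(@filter_ex _ F)[w /(_ (Ordinal (fK (p w))))].
  by rewrite eqxx.
apply: neq; have Fd : F [set w | f (q w) = c] by apply/(pq [set k | f k = c]).
by apply: filterS2 Fc Fd => w /= -> ->.
Qed.

(** The color is the parity of the number of steps during which the iterates of g keep decreasing
    from k; m is fuel, and any m > k is enough. *)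
Lemma parity_coloring (g : nat -> nat) :
  exists c : nat -> bool, forall k, g k < k -> c k = ~~ c (g k).
Proof.
pose c := fix c m k {struct m} :=
  if m is m'.+1 then (g k < k) && ~~ c m' (g k) else false.
have cE m m' k : k < m -> k < m' -> c m k = c m' k.
  elim: m m' k => // m IHm [//|m'] k km km' /=.
  by case: ltnP => //= gk; rewrite (IHm m')//; lia.
exists (fun k => c k.+1 k) => k gk /=; rewrite gk /=.
by rewrite (cE k (g k).+1).
Qed.

(** On D, q is a function g of p. Where g decreases, the parity coloring separates p from q, while
    equal types have equal colors. *)
Lemma same_type_not_decreasing (D : set T) p q : same_type p q -> F D ->
  (forall w w', D w -> D w' -> p w = p w' -> q w = q w') ->
  ~ F [set w | q w < p w].
Proof.
move=> pq FD Dfun qp.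
have [g gP] : exists g : nat -> nat, forall w, D w -> g (p w) = q w.
  have : forall k, exists m, forall w, D w -> p w = k -> m = q w.
    move=> k; have [[w [Dw pw]]|no] := pselect (exists w, D w /\ p w = k).
      by exists (q w) => w' Dw' pw'; apply: Dfun; rewrite // pw pw'.
    by exists 0 => w Dw pw; case: no; exists w.
  by move=> /choice[g gP]; exists g => w Dw; exact: gP.
have [c cP] := parity_coloring g.
have ccol : F [set w | (c (p w) : nat) = c (q w)].
  by apply: (same_type_color (f := fun k => c k) (K := 2)) => // k; case: (c k).
have [w [Dw [/= qpw]]] := @filter_ex _ F _ _ (filterI FD (filterI qp ccol)).
have := cP (p w); rewrite gP// => /(_ qpw) ->.
by case: (c (q w)).
Qed.

(** The ratio q / p would lie between A / B > 1 and C. On the scale [L] of logarithms in base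
    2^(1/B), q is then at least 1 and at most K = C^B above p, so [L] modulo K + 1 distinguishes
    them. *)
Lemma same_type_ratio A B C p q : same_type p q -> 0 < B < A ->
  F [set w | 0 < p w] ->
  F [set w | A * p w <= B * q w] -> ~ F [set w | q w <= C * p w].
Proof.
move=> pq /andP[B_gt0 BA] p_gt0 pqF qpF.
pose L k := trunc_log 2 (k ^ B).
pose K := C ^ B.
have col : F [set w | L (p w) %% K.+1 = L (q w) %% K.+1].
  by apply: (same_type_color (f := fun k => L k %% K.+1) (K := K.+1)) => // k;
    rewrite ltn_pmod.
have [w [[/= p0 Apq] [qCp]]] := @filter_ex _ F _ _
  (filterI (filterI p_gt0 pqF) (filterI qpF col)).
move: (p w) (q w) p0 Apq qCp => {pq p_gt0 pqF qpF col p q w} p q p0 Apq qCp.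
have q0 : 0 < q.
  by move: Apq; case: q {qCp} => //; rewrite muln0 leqn0 muln_eq0; lia.
(* Bernoulli's inequality: (1 + 1/B)^B >= 2. *)
have pow2 : 2 * B ^ B <= B.+1 ^ B.
  have bern m : B ^ m * (B + m) <= B * B.+1 ^ m.
    elim: m => [|m IHm]; first by rewrite !expn0 addn0 mul1n muln1.
    rewrite !expnS; move: (B ^ m) (B.+1 ^ m) IHm => u v uv.
    have : u * (B + m) * B.+1 <= B * v * B.+1 by rewrite leq_mul2r uv orbT.
    nia.
  by have := bern B; rewrite addnn -mul2n mulnA [_ * 2]mulnC -mulnA
    [B ^ B * B]mulnC mulnCA leq_pmul2l.
have Lpq : L p < L q.
  rewrite /L -trunc_logMp ?expn_gt0 ?p0//; apply: leq_trunc_log.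
  rewrite -(@leq_pmul2l (B ^ B)) ?expn_gt0 ?B_gt0// mulnCA mulnA -expnMn.
  apply: (@leq_trans (B.+1 ^ B * p ^ B)); first by rewrite leq_mul2r pow2 orbT.
  rewrite -expnMn leq_exp2r//; apply: leq_trans Apq.
  by rewrite leq_mul2r BA orbT.
have LqK : L q <= L p + K.
  have : trunc_log 2 (2 ^ K * p ^ B) = L p + K.
    elim: K => [|k IHk]; first by rewrite expn0 mul1n addn0.
    by rewrite expnS -mulnA trunc_logMp ?muln_gt0 ?expn_gt0 ?p0// IHk addnS.
  move=> <-; apply: leq_trunc_log.
  apply: (@leq_trans ((C * p) ^ B)); first by rewrite leq_exp2r.
  by rewrite expnMn leq_mul2r (ltnW (ltn_expl _ _)) ?orbT.
move=> /esym/eqP; rewrite eqn_mod_dvd; last exact: ltnW.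
by move=> /dvdn_leq; lia.
Qed.

(** Otherwise f would be injective on an infinite homogeneous set, yet bounded by phi(i) on its
    members beyond a fixed i. *)
Lemma ramsey_dichotomy (f phi : nat -> nat) :
  F [set w | f (x w) = f (y w)] \/ F [set w | phi (x w) < f (y w)].
Proof.
have [|neq] := in_ultra_setVsetC [set w | f (x w) = f (y w)] UF; first by left.
have [|le] := in_ultra_setVsetC [set w | phi (x w) < f (y w)] UF;
  first by right.
exfalso.
have [|H [unbH HA]] :=
    triple_ramsey RF (A := fun i j => f i <> f j /\ f j <= phi i).
  by apply: filterS2 neq le => w /= ? /negP; rewrite -leqNgt.
have [i Hi _] := unbH 0.
pose K := [set j | H j /\ i < j].
have unbK : unbounded K.
  move=> m; have [j Hj mj] := unbH (m + i).
  exists j; last by apply: leq_ltn_trans mj; exact: leq_addr.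
  by split=> //; apply: leq_ltn_trans mj; exact: leq_addl.
have /unbounded_infinite infK := unbK; apply: infK.
have fI : {in K &, injective f}.
  move=> j k /[!inE] -[Hj ij] [Hk ik] fjk.
  have [jk|kj|//] := ltngtP j k; first by have [] := HA _ _ Hj Hk jk.
  by have [/nesym] := HA _ _ Hk Hj kj.
apply: (@finite_image_injective _ _ f) => //.
apply: sub_finite_set (finite_II (phi i).+1) => _ [j [Hj ij] <-] /=.
by rewrite ltnS; case: (HA _ _ Hi Hj ij).
Qed.

Lemma ramsey_neq : ~ F [set w | x w = y w].
Proof.
move=> /(triple_ramsey RF (A := fun i j => i = j))[H [unbH HA]].
have [i Hi _] := unbH 0; have [j Hj ij] := unbH i.
by move: (ij); rewrite (HA i j)// ltnn.
Qed.

Lemma eventually_y (S : nat -> nat -> Prop) :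
  (forall i, exists N, forall j, N <= j -> S i j) -> F [set w | S (x w) (y w)].
Proof.
move=> /choice[N NS]; have [/ramsey_neq//|] := ramsey_dichotomy id N.
by apply: filterS => w /= /ltnW; exact: NS.
Qed.

(** * Sizes, degrees and leading coefficients in the equation *)

Section Equation.

Local Open Scope ring_scope.

Variables (a n : nat) (P Q : {poly int}).
Hypotheses (a_gt0 : (0 < a)%N) (n_gt0 : (0 < n)%N).
Hypotheses (P_neq0 : P != 0) (Q_neq0 : Q != 0).
Hypotheses (P0 : P.[0] = 0) (Q0 : Q.[0] = 0).
Hypothesis eqF : F [set w |
  (a * x w ^ n)%N%:Z + P.[(y w)%:Z] = Q.[(z w)%:Z]].

Let x_gt0 : F [set w | (0 < x w)%N] := triple_gt0 RF.
Let xy : same_type x y := triple_xy RF.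
Let yz : same_type y z := triple_yz RF.
Let zy : same_type z y. Proof. by move=> A; apply: iff_sym. Qed.
Let y_gt0 : F [set w | (0 < y w)%N]. Proof. exact/(xy [set k | 0 < k]%N). Qed.
Let z_gt0 : F [set w | (0 < z w)%N]. Proof. exact/(yz [set k | 0 < k]%N). Qed.

(** z too exceeds every function N of x: |P(y)| is larger than a x^n plus all |Q(k)| with k <
    N(x). *)
Lemma eventually_z (S : nat -> nat -> Prop) :
  (forall i, exists N, forall j, (N <= j)%N -> S i j) ->
  F [set w | S (x w) (z w)].
Proof.
move=> /choice[N NS].
have big : F [set w |
    (a * x w ^ n + \sum_(k < N (x w)) `|Q.[k%:Z]|).+1%N%:Z <= `|P.[(y w)%:Z]|].
  apply: (@eventually_y (fun i j =>
    (a * i ^ n + \sum_(k < N i) `|Q.[k%:Z]|).+1%N%:Z <= `|P.[j%:Z]|)) => i.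
  exact: (poly_norm_unbounded (poly_size_gt1 P_neq0 P0)).
apply: filterS2 eqF big => w /= e bigw; apply: NS; rewrite leqNgt.
apply/negP => zN; move: bigw; rewrite (bigD1 (Ordinal zN))//= -e; lia.
Qed.

(** Two points with the same y have Q-values no further apart than the larger of their a x^n;
    isolation at that point identifies their z, so z is a function of y. *)
Lemma z_not_lt_y : (2 < size Q)%N -> ~ F [set w | z w < y w]%N.
Proof.
move=> sQ.
have iso : F [set w | forall k : nat,
    `|Q.[k%:Z] - Q.[(z w)%:Z]| <= (a * x w ^ n)%N%:Z -> k = z w].
  apply: (@eventually_z (fun i j => forall k : nat,
    `|Q.[k%:Z] - Q.[j%:Z]| <= (a * i ^ n)%N%:Z -> k = j)) => i.
  exact: poly_values_isolated.
apply: (same_type_not_decreasing yz (filterI eqF iso)).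
have main w w' : (x w <= x w')%N -> y w = y w' ->
    (a * x w ^ n)%N%:Z + P.[(y w)%:Z] = Q.[(z w)%:Z] ->
    (a * x w' ^ n)%N%:Z + P.[(y w')%:Z] = Q.[(z w')%:Z] ->
    `|Q.[(z w)%:Z] - Q.[(z w')%:Z]| <= (a * x w' ^ n)%N%:Z.
  move=> xx -> <- <-.
  have : (a * x w ^ n <= a * x w' ^ n)%N.
    by rewrite leq_mul2l leq_exp2r// xx orbT.
  by move: (a * x w ^ n)%N (a * x w' ^ n)%N => s t st; lia.
move=> w w' [/= e iw] [/= e' iw'] yy.
have [xx|xx] := leqP (x w) (x w'); first by apply: iw'; exact: main.
by apply/esym/iw/main => //; exact: ltnW.
Qed.

Lemma y_not_lt_z : (2 < size P)%N -> ~ F [set w | y w < z w]%N.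
Proof.
move=> sP.
have iso : F [set w | forall k : nat,
    `|P.[k%:Z] - P.[(y w)%:Z]| <= (a * x w ^ n)%N%:Z -> k = y w].
  apply: (@eventually_y (fun i j => forall k : nat,
    `|P.[k%:Z] - P.[j%:Z]| <= (a * i ^ n)%N%:Z -> k = j)) => i.
  exact: poly_values_isolated.
apply: (same_type_not_decreasing zy (filterI eqF iso)).
have main w w' : (x w <= x w')%N -> z w = z w' ->
    (a * x w ^ n)%N%:Z + P.[(y w)%:Z] = Q.[(z w)%:Z] ->
    (a * x w' ^ n)%N%:Z + P.[(y w')%:Z] = Q.[(z w')%:Z] ->
    `|P.[(y w)%:Z] - P.[(y w')%:Z]| <= (a * x w' ^ n)%N%:Z.
  move=> xx -> <-.
  have : (a * x w ^ n <= a * x w' ^ n)%N.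
    by rewrite leq_mul2l leq_exp2r// xx orbT.
  by move: (a * x w ^ n)%N (a * x w' ^ n)%N => s t st; lia.
move=> w w' [/= e iw] [/= e' iw'] yy.
have [xx|xx] := leqP (x w) (x w'); first by apply: iw'; exact: main.
by apply/esym/iw/main => //; exact: ltnW.
Qed.

(** Otherwise a x^n = (Q - P)(y), which is either 0 or too large. *)
Lemma z_neq_y : ~ F [set w | z w = y w].
Proof.
move=> zyF.
have [PQ|PQ] := eqVneq (Q - P) 0.
  have [w [[/= e zw] x0]] := @filter_ex _ F _ _
    (filterI (filterI eqF zyF) x_gt0).
  move: e; rewrite zw (subr0_eq PQ) => /eqP; rewrite -subr_eq0 addrK eqz_nat.
  by rewrite muln_eq0 expn_eq0; lia.
have PQ0 : (Q - P).[0] = 0 by rewrite !hornerE P0 Q0 subrr.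
have big : F [set w | (a * x w ^ n).+1%N%:Z <= `|(Q - P).[(y w)%:Z]|].
  apply: (@eventually_y (fun i j =>
    (a * i ^ n).+1%N%:Z <= `|(Q - P).[j%:Z]|)) => i.
  exact: (poly_norm_unbounded (poly_size_gt1 PQ PQ0)).
have [w [[/= e zw] bigw]] := @filter_ex _ F _ _ (filterI (filterI eqF zyF) big).
move: bigw => /=; rewrite hornerD hornerN -[in Q.[_]]zw -e.
by move: (a * x w ^ n)%N P.[_] => s t; rewrite addrK; lia.
Qed.

(** If y <= z, the left side is at most (1 + |p|) z in absolute value, with p the slope of P, while
    |Q(z)| is at least (2 + |p|) z. *)
Lemma z_lt_y : (2 < size Q)%N -> (size P <= 2)%N -> F [set w | z w < y w]%N.
Proof.
move=> sQ sP.
have big : F [set w | (2 + `|(P`_1)%R|)%N%:Z * (z w)%:Z <= `|Q.[(z w)%:Z]|].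
  apply: (@eventually_z (fun _ j =>
    (2 + `|(P`_1)%R|)%N%:Z * j%:Z <= `|Q.[j%:Z]|)) => _.
  exact: (poly_superlinear Q0 sQ).
have small : F [set w | (a * x w ^ n <= y w)%N].
  apply: (@eventually_y (fun i j => (a * i ^ n <= j)%N)) => i.
  by exists (a * i ^ n)%N.
apply: filterS (filterI (filterI eqF z_gt0) (filterI big small)) => w.
move=> [[/= e zw] [bigw smallw]].
rewrite ltnNge; apply/negP => yz'.
move: e bigw smallw; rewrite {1}(poly_linear P0 sP) hornerZ hornerX => <-.
move: (a * x w ^ n)%N P`_1 (y w) (z w) zw yz' => s p k m m0 km h1 h2.
have : `|p * k%:Z| <= `|p| * m%:Z by rewrite normrM; nia.
nia.
Qed.

Lemma y_lt_z : (2 < size P)%N -> (size Q <= 2)%N -> F [set w | y w < z w]%N.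
Proof.
move=> sP sQ.
have big : F [set w | (2 + `|(Q`_1)%R|)%N%:Z * (y w)%:Z <= `|P.[(y w)%:Z]|].
  apply: (@eventually_y (fun _ j =>
    (2 + `|(Q`_1)%R|)%N%:Z * j%:Z <= `|P.[j%:Z]|)) => _.
  exact: (poly_superlinear P0 sP).
have small : F [set w | (a * x w ^ n <= y w)%N].
  apply: (@eventually_y (fun i j => (a * i ^ n <= j)%N)) => i.
  by exists (a * i ^ n)%N.
apply: filterS (filterI (filterI eqF y_gt0) (filterI big small)) => w.
move=> [[/= e yw] [bigw smallw]].
rewrite ltnNge; apply/negP => zy'.
move: e bigw smallw; rewrite {1}(poly_linear Q0 sQ) hornerZ hornerX.
move=> /(canRL (addKr _)) ->.
move: (a * x w ^ n)%N Q`_1 (y w) (z w) yw zy' => s q k m k0 mk h1 h2.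
have : `|q * m%:Z| <= `|q| * k%:Z by rewrite normrM; nia.
nia.
Qed.

Lemma degrees_le1 : (size P <= 2)%N /\ (size Q <= 2)%N.
Proof.
have tri : F [set w | y w < z w]%N \/ F [set w | z w < y w]%N.
  have [|zy'] := in_ultra_setVsetC [set w | y w < z w]%N UF; first by left.
  have [|yz'] := in_ultra_setVsetC [set w | z w < y w]%N UF; first by right.
  case: z_neq_y; apply: filterS2 zy' yz' => w /= /negP + /negP.
  by rewrite -!leqNgt => ? ?; apply/eqP; rewrite eqn_leq; apply/andP.
have [sP|sP] := leqP (size P) 2; have [sQ|sQ] := leqP (size Q) 2 => //.
- by case: (z_not_lt_y sQ); exact: z_lt_y.
- by case: (y_not_lt_z sP); exact: y_lt_z.
- by case: tri => [/(y_not_lt_z sP)|/(z_not_lt_y sQ)].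
Qed.

(** As 2 a x^n < y, the ratio z / y is close to |p| / |q|. If |p| and |q| differ, it is bounded and
    bounded away from 1, against [same_type_ratio]. If p = - q, then a x^n = q (y + z), which is too
    large. *)
Lemma leading_coefs_eq : P`_1 = Q`_1.
Proof.
have [sP sQ] := degrees_le1.
move: (P`_1) (Q`_1) (poly_linear P0 sP) (poly_linear Q0 sQ) => p q PE QE.
have p0 : p != 0 by apply: contra_neq P_neq0 => p0; rewrite PE p0 scale0r.
have q0 : q != 0 by apply: contra_neq Q_neq0 => q0; rewrite QE q0 scale0r.
have eqL : F [set w | (a * x w ^ n)%N%:Z + p * (y w)%:Z = q * (z w)%:Z].
  by apply: filterS eqF => w /=; rewrite PE QE !hornerZ !hornerX.
have small : F [set w | 2 * (a * x w ^ n) < y w]%N.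
  apply: (@eventually_y (fun i j => 2 * (a * i ^ n) < j)%N) => i.
  by exists (2 * (a * i ^ n)).+1%N.
have near w : (a * x w ^ n)%N%:Z + p * (y w)%:Z = q * (z w)%:Z ->
    (`|q| * z w <= `|p| * y w + a * x w ^ n)%N /\
    (`|p| * y w <= `|q| * z w + a * x w ^ n)%N.
  have qz : (`|q| * z w)%N = `|(q * (z w)%:Z)%R|%N by rewrite abszM.
  have py : (`|p| * y w)%N = `|(p * (y w)%:Z)%R|%N by rewrite abszM.
  by rewrite qz py; move: (q * _) (p * _) (a * _)%N => ? ? ?; lia.
have pq_abs : `|p|%N = `|q|%N.
  have [pq|pq|//] := ltngtP `|p|%N `|q|%N; exfalso.
  (* With 2 a x^n < y, [near] gives 2 |q| z <= (2 |p| + 1) y and (2 |p| - 1) y <= 2 |q| z, whence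
     the constants in both cases. *)
  - apply: (@same_type_ratio (2 * `|q|) (2 * `|p|).+1 (2 * `|q|) _ _ zy) => //.
    + by move: pq; clear; lia.
    + apply: filterS2 eqL small => w /= /near[h1 h2] h3.
      by move: h1 h2 h3; move: (a * _)%N => s; nia.
    + apply: filterS2 eqL small => w /= /near[h1 h2] h3.
      have p1 : (0 < `|p|)%N by rewrite absz_gt0.
      by move: h1 h2 h3; move: (a * _)%N => s; nia.
  - apply: (@same_type_ratio (2 * `|p|).-1 (2 * `|q|) (`|p|.+1) _ _ yz) => //.
    + have q1 : (0 < `|q|)%N by rewrite absz_gt0.
      by move: pq q1; clear; lia.
    + apply: filterS2 eqL small => w /= /near[h1 h2] h3.
      by move: h1 h2 h3; move: (a * _)%N => s; nia.
    + apply: filterS2 eqL small => w /= /near[h1 h2] h3.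
      have q1 : (0 < `|q|)%N by rewrite absz_gt0.
      by move: h1 h2 h3; move: (a * _)%N => s; nia.
have [//|pq] : p = q \/ p = - q by move: pq_abs; clear; lia.
have [w [/= e ltsy]] := @filter_ex _ F _ _ (filterI eqL small).
have : (a * x w ^ n)%N%:Z = q * ((y w)%:Z + (z w)%:Z).
  by rewrite mulrDr -e pq; ring.
move/(congr1 absz); rewrite abszM /=.
have q1 : (0 < `|q|)%N by rewrite absz_gt0.
by move: (a * _)%N ltsy => s ?; nia.
Qed.

(** All the events needed have probability 1, so a single standard point satisfies them together and
    [digit_analysis] applies to it. *)
Lemma equation_solved : n = 1%N /\
  (P = a%:Z *: 'X /\ Q = a%:Z *: 'X \/ P = - a%:Z *: 'X /\ Q = - a%:Z *: 'X).
Proof.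
have [sP sQ] := degrees_le1; have pq := leading_coefs_eq.
move: (P`_1) pq (poly_linear P0 sP) (poly_linear Q0 sQ) => p <- PE QE.
have p0 : p != 0 by apply: contra_neq P_neq0 => p0; rewrite PE p0 scale0r.
have [l apl l_prime] := prime_above (a + `|p|).
have l_gt0 := prime_gt0 l_prime.
have xz : same_type x z by move=> A; rewrite xy.
have digit_lt t i : (digit l t i < l)%N by rewrite ltn_pmod.
have mod_yz : F [set w | y w = z w %[mod l]].
  by apply: (same_type_color (f := modn^~ l) yz) => k; exact: ltn_pmod.
have lead_xz : F [set w |
    digit l (x w) (logn l (x w)) = digit l (z w) (logn l (z w))].
  exact: (same_type_color (f := fun k => digit l k (logn l k)) xz).
have lead_yz : F [set w |
    digit l (y w) (logn l (y w)) = digit l (z w) (logn l (z w))].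
  exact: (same_type_color (f := fun k => digit l k (logn l k)) yz).
have digit_yz : F [set w |
    digit l (y w) (n * logn l (y w)) = digit l (z w) (n * logn l (z w))].
  exact: (same_type_color (f := fun k => digit l k (n * logn l k)) yz).
have log_xz : F [set w | odd (trunc_log n (logn l (x w))) =
    odd (trunc_log n (logn l (z w))) :> nat].
  apply: (same_type_color (f := fun k => odd (trunc_log n (logn l k)))
    (K := 2) xz).
  by move=> k; case: odd.
have val_xy : F [set w | logn l (x w) = logn l (y w) \/
    (n * logn l (x w) < logn l (y w))%N].
  have [h|h] := ramsey_dichotomy (logn l) (fun i => n * logn l i)%N.
  - by apply: filterS h => w; left.
  - by apply: filterS h => w; right.
have [w [[[/= x0 y0] [z0 e]] [[m1 [m2 m3]] [m4 [m5 m6]]]]] := @filter_ex _ F _ _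
  (filterI (filterI (filterI x_gt0 y_gt0) (filterI z_gt0 eqF))
    (filterI (filterI mod_yz (filterI lead_xz lead_yz))
      (filterI digit_yz (filterI log_xz val_xy)))).
have eqw : (a * x w ^ n)%N%:Z + p * (y w)%:Z = p * (z w)%:Z.
  by move: e; rewrite PE QE !hornerZ !hornerX.
have m5' : odd (trunc_log n (logn l (x w))) = odd (trunc_log n (logn l (z w))).
  by move: m5 => /=; case: odd; case: odd.
have [-> pa] := digit_analysis l_prime apl a_gt0 p0 n_gt0 x0 y0 z0 eqw
  m1 m2 m3 m4 m5' m6.
by split=> //; rewrite PE QE; case: pa => ->; [left|right].
Qed.

End Equation.

End RamseyTriple.

(** * The equivalence *)

Local Open Scope ring_scope.

Lemma meval_horner_intr k (v : 'I_k -> int) (R : {poly int})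
    (t : {mpoly int[k]}) :
  meval v (map_poly intr R).[t] = R.[meval v t].
Proof.
rewrite -horner_map -map_poly_comp; congr _.[_].
rewrite -[RHS](@map_poly_id _ id)//; apply: eq_map_poly => c /=.
by rewrite rmorph_int intz.
Qed.

Theorem theoremB (X : nonstandard_extension) (P Q : {poly int}) (a n : posN)
    (hP : P != 0) (hQ : Q != 0) (hP0 : P.[0] = 0) (hQ0 : Q.[0] = 0) :
  (exists alpha beta gamma : X,
     [/\ equi alpha beta, equi beta gamma, ramsey_pair alpha beta &
         star_eq (fun w : 3.-tuple posN =>
                    (a : nat)%:Z * ((tnth w 0 : nat)%:Z) ^+ n
                      + P.[(tnth w 1 : nat)%:Z])
                 (fun w => Q.[(tnth w 2%:R : nat)%:Z])
                 [tuple alpha; beta; gamma]])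
  <->
  (let x : {mpoly int[3]} := 'X_0 in
   let y : {mpoly int[3]} := 'X_1 in
   let z : {mpoly int[3]} := 'X_(2%:R) in
   let f := (a : nat)%:R * x ^+ n
              + (map_poly intr P).[y] - (map_poly intr Q).[z] in
   f = (a : nat)%:R * (x + y - z) \/ f = (a : nat)%:R * (x - y + z)).
Proof.
pose S (i j k : nat) := (a : nat)%:Z * i%:Z ^+ n + P.[j%:Z] = Q.[k%:Z].
split=> [[b [c [d [bc cd Rbc Sbcd]]]] /=|/= f_eq].
  have Rw := nonstandard_triple bc cd Rbc.
  have [|n1 PQ] := @equation_solved _ _ _ _ _ (ultra_UltraFilter b c d) Rw
    a n P Q (posN_gt0 a) (posN_gt0 n) hP hQ hP0 hQ0.
    have UU := ultra_UltraFilter b c d.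
    by apply: filterS Sbcd => w; rewrite /S /= PoszM -rmorphXn.
  rewrite n1 expr1.
  have evalE (k : int) (t : {mpoly int[3]}) :
      (map_poly intr (k *: 'X)).[t] = k%:~R * t.
    by rewrite map_polyZ map_polyX hornerZ hornerX.
  by case: PQ => -[-> ->]; [left|right]; rewrite !evalE ?rmorphN /= ; ring.
(* For the converse, the polynomial identity is evaluated at the integer points (i, j, k). *)
pose v (i j k : nat) (o : 'I_3) : int := nth 0 [:: i%:Z; j%:Z; k%:Z] o.
have eval i j k : (a : nat)%:R * (i%:Z) ^+ n + P.[j%:Z] - Q.[k%:Z] =
    meval (v i j k) ((a : nat)%:R * 'X_0 ^+ n + (map_poly intr P).['X_1]
      - (map_poly intr Q).['X_(2%:R)]).
  rewrite rmorphB rmorphD rmorphM rmorphXn rmorph_nat /=.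
  by rewrite !meval_horner_intr !mevalXU.
suff [T [F [x [y [z [UF RF SF]]]]]] : exists (T : Type) (F : set_system T)
    (x y z : T -> nat), [/\ UltraFilter F, ramsey_triple F x y z &
      F [set w | S (x w) (y w) (z w)]].
  have [b [c [d [bc cd Rbc Sbcd]]]] := triple_nonstandard X UF RF SF.
  by exists b, c, d.
case: f_eq => f_eq.
- have [F [x [y [z [UF RF xyz]]]]] := sum_triple.
  exists (nat * nat)%type, F, x, y, z; split=> //.
  apply: filterS xyz => w /= xyz; apply/eqP.
  rewrite -subr_eq0 -[a%:Z]natz eval f_eq.
  rewrite rmorphM rmorphB rmorphD /= !mevalXU /v /=.
  by rewrite -xyz PoszD subrr mulr0.
- have [F [x [y [z [UF RF xzy]]]]] := difference_triple.
  exists (nat * (nat * nat))%type, F, x, y, z; split=> //.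
  apply: filterS xzy => w /= xzy; apply/eqP.
  rewrite -subr_eq0 -[a%:Z]natz eval f_eq.
  rewrite rmorphM rmorphD rmorphB /= !mevalXU /v /=.
  by rewrite -xzy PoszD addrAC subrr mulr0.
Qed.
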